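(* Let $n$ be a positive integer and let $x_1$ be a positive integer whose orbit $x_1, x_2 = Col(x_1), \dots, x_{n} = Col^{n-1}(x_1)$ has step sizes $m_1, m_2, \dots, m_n$ (where $m_i$ is the step size of $x_i$) with $m_n = 1$. Let $D(n) = 4 \cdot 2^{m_1 + m_2 + \cdots + m_{n-1}}$. Then for every natural number $R$, the orbit starting at $x_1' = x_1 + R\,D(n)$ shares the same orbit rhythm of length $n$ as the orbit of $x_1$; that is, for each $i \in \{1,\dots,n\}$ the step size of $Col^{i-1}(x_1')$ equals $m_i$. Consequently the orbits starting at $x_1, x_1 + D(n), x_1 + 2D(n), \dots$ form a class of orbits sharing the orbit rhythm $\langle m_1,\dots,m_n\rangle$.
   Context: The Collatz map $Col$ on the positive integers is defined as follows. If $x$ is odd, $Col(x) = (3x+1)/2^{m}$, where $m \ge 1$ is the exponent of the largest power of $2$ dividing $3x+1$; if $x$ is even, $Col(x) = x/2^{m}$, where $m \ge 1$ is the exponent of the largest power of $2$ dividing $x$. In either case this exponent $m$ is called the step size of $x$. $Col^{0}(x) = x$ and $Col^{i+1}(x) = Col(Col^{i}(x))$. Two orbits (starting at $x$ and $x'$) share the orbit rhythm of length $n$ if the step sizes of $Col^{i-1}(x)$ and $Col^{i-1}(x')$ agree for all $i = 1,\dots,n$; the sequence $\langle m_1,\dots,m_n\rangle$ of these step sizes is the orbit rhythm. *)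

(* Defs.v *)
From mathcomp Require Import all_boot.

Set Implicit Arguments.
Unset Strict Implicit.
Unset Printing Implicit Defensive.

(* Positive integers are elements of [nat] with an explicit
   positivity hypothesis; at the junk value [0], [step_size] and [Col] are 0. *)

Definition collatz_num (x : nat) : nat := if odd x then 3 * x + 1 else x.

(* [logn 2 y] is the exponent of the largest power of 2 dividing [y > 0]. *)
Definition step_size (x : nat) : nat := logn 2 (collatz_num x).

(* The division is exact. *)
Definition Col (x : nat) : nat := collatz_num x %/ 2 ^ step_size x.

Definition shares_rhythm (n x x' : nat) : Prop :=
  forall i, 1 <= i <= n ->
    step_size (iter (i - 1) Col x) = step_size (iter (i - 1) Col x').

Definition orbit_rhythm (n x : nat) : seq nat :=
  [seq step_size (iter (i - 1) Col x) | i <- iota 1 n].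

(* Step sizes are indexed from 1, so the exponent is m_1 + ... + m_(n-1). *)
Definition D (m : nat -> nat) (n : nat) : nat :=
  4 * 2 ^ (\sum_(1 <= i < n) m i).

(* Main.v *)
(** If [2 ^ (e + s) %| d], where [s] is the step size of [x] and [0 < e], then
    [x] and [x + d] have the same parity and the same step size, and their
    images under [Col] differ by a multiple of [2 ^ e]: each step consumes
    exactly its own step size from the 2-adic valuation of the difference.
    The factor [4 = 2 ^ (m_n + 1)] in [D m n] is what remains for the
    [n]-th step. *)

Require Import Defs.
From mathcomp Require Import all_boot.

(** [p ^ logn p a] divides both summands, while the next power of [p] divides [b] but not [a], hence
    not the sum. *)
Lemma logn_addr p a b :
  prime p -> 0 < a -> p ^ (logn p a).+1 %| b -> logn p (a + b) = logn p a.
Proof.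
move=> p_pr a0 pb; have ab0 : 0 < a + b by rewrite addn_gt0 a0.
apply/eqP; rewrite eqn_leq leqNgt -!(pfactor_dvdn _ p_pr ab0).
rewrite dvdn_addl // (pfactor_dvdn _ p_pr a0) ltnn /= dvdn_add ?pfactor_dvdnn //.
exact: dvdn_trans (dvdn_exp2l _ (leqnSn _)) pb.
Qed.

Lemma collatz_num_gt0 x : 0 < x -> 0 < collatz_num x.
Proof. by rewrite /collatz_num; case: odd; rewrite ?addn1. Qed.

Lemma collatz_num_add_even x d :
  ~~ odd d -> collatz_num (x + d) = collatz_num x + (if odd x then 3 else 1) * d.
Proof.
move=> /negbTE d_even; rewrite /collatz_num oddD d_even addbF.
by case: odd; rewrite ?mul1n // mulnDr addnAC.
Qed.

Lemma odd_mul_pow2 r e : 0 < e -> odd (r * 2 ^ e) = false.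
Proof. by move=> e0; rewrite oddM oddX orbF eqn0Ngt e0 andbF. Qed.

(** The strict inequality keeps the shift even and supplies the extra factor 2 that [logn_addr]
    demands. *)
Lemma step_size_add x r e :
  0 < x -> step_size x < e -> step_size (x + r * 2 ^ e) = step_size x.
Proof.
move=> x0 lt_se; rewrite /step_size collatz_num_add_even; last first.
  by rewrite odd_mul_pow2 // (leq_ltn_trans _ lt_se).
apply: logn_addr => //; first exact: collatz_num_gt0.
by rewrite mulnA dvdn_mull // dvdn_exp2l.
Qed.

Lemma Col_gt0 x : 0 < x -> 0 < Col x.
Proof.
move=> x0; rewrite divn_gt0 ?expn_gt0 //.
by rewrite dvdn_leq ?pfactor_dvdnn ?collatz_num_gt0.
Qed.

Lemma iter_Col_gt0 j x : 0 < x -> 0 < iter j Col x.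
Proof. by move=> x0; elim: j => // j; apply: Col_gt0. Qed.

Lemma Col_add x r e :
  0 < x -> 0 < e ->
  exists r', Col (x + r * 2 ^ (step_size x + e)) = Col x + r' * 2 ^ e.
Proof.
(* The shift is scaled by the slope of the affine branch that [x] takes. *)
move=> x0 e0; exists ((if odd x then 3 else 1) * r).
have lt_s : step_size x < step_size x + e by rewrite -addn1 leq_add2l.
rewrite /Col step_size_add //.
rewrite collatz_num_add_even ?odd_mul_pow2 ?addn_gt0 ?e0 ?orbT //.
rewrite divnDl ?pfactor_dvdnn // mulnA expnD mulnCA.
by rewrite mulKn ?expn_gt0.
Qed.

Lemma iter_Col_add j x r e :
  0 < x -> 0 < e ->
  exists r', iter j Col (x + r * 2 ^ (\sum_(i < j) step_size (iter i Col x) + e))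
             = iter j Col x + r' * 2 ^ e.
Proof.
move=> x0; elim: j e => [|j IHj] e e0; first by exists r; rewrite big_ord0.
(* The larger exponent reserves the factors of 2 that the next application of [Col] divides out. *)
have [r' IH] := IHj (step_size (iter j Col x) + e) (ltn_addl _ e0).
rewrite big_ord_recr -addnA /= IH.
exact: Col_add (iter_Col_gt0 _ _ x0) e0.
Qed.

Theorem theorem3 (n x1 : nat) (m : nat -> nat)
  (hn : 0 < n) (hx1 : 0 < x1)
  (hm : forall i, 1 <= i <= n -> step_size (iter (i - 1) Col x1) = m i)
  (hmn : m n = 1) :
  (forall R : nat,
     shares_rhythm n x1 (x1 + R * D m n) /\
     (forall i, 1 <= i <= n ->
        step_size (iter (i - 1) Col (x1 + R * D m n)) = m i)) /\
  (forall R R' : nat,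
     shares_rhythm n (x1 + R * D m n) (x1 + R' * D m n)) /\
  (forall R : nat,
     orbit_rhythm n (x1 + R * D m n) = [seq m i | i <- iota 1 n]).
Proof.
have steps R i : 1 <= i <= n ->
    step_size (iter (i - 1) Col (x1 + R * D m n)) = m i.
  move=> /andP[i0 le_in].
  (* The exponent of 2 still guaranteed in the difference after [i - 1] steps; the 2 comes from the
     factor 4. *)
  set e := \sum_(i <= k < n) m k + 2.
  have lt_mi_e : m i < e.
    (* For [i < n] the sum contains [m i] and the 2 makes the bound strict; for [i = n] the sum is
       empty and [m n = 1 < 2]. *)
    rewrite /e; case: (ltngtP i n) le_in => // [lt_in _|-> _].
      by rewrite big_ltn // -addnA -[X in X < _]addn0 ltn_add2l addn2.
    by rewrite hmn addn2.
  have -> : D m n = 2 ^ (\sum_(j < i - 1) step_size (iter j Col x1) + e).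
    rewrite /D (big_cat_nat i0 le_in) /= -(expnD 2 2) addnC -addnA; congr (2 ^ (_ + _)).
    (* Shifting the index by one matches [m j.+1] with the step size of [iter j Col x1]. *)
    rewrite big_add1 -subn1 big_mkord.
    apply: eq_bigr => j _; rewrite -hm ?(subn1 j.+1) //=.
    exact: leq_trans (leq_trans (ltn_ord j) (leq_subr 1 i)) le_in.
  have e0 : 0 < e by apply: leq_ltn_trans lt_mi_e.
  have [r' ->] := iter_Col_add (i - 1) x1 R e hx1 e0.
  by rewrite step_size_add ?iter_Col_gt0 // hm // i0.
split; first by move=> R; split; [move=> i hi; rewrite steps // hm | exact: steps].
split=> [R R' i hi | R]; first by rewrite !steps.
apply/eq_in_map => i; rewrite mem_iota add1n ltnS; exact: steps.
Qed.
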